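(* For every integer $n\ge 5$, $$2\sum_{\substack{i\ge 2,\;j,l\ge 1\\ i+j+l=n-1}}\zeta(i,1,j,l)-\sum_{\substack{i\ge 2,\;j,k,l\ge 1\\ i+j+k+l=n}}\bigl(2^{i-1}+2^{k}\bigr)\zeta(i,j,k,l)-\sum_{\substack{k\ge 2,\;j\ge 1\\ k+j=n-1}}k\,\zeta(k,1,j)$$ $$=2\,\zeta(2,n-2)+(n-3)\,\zeta(n-2,2)-(2n-5)\,\zeta(n-1,1)-\frac{n+5}{2}\,\zeta(n).$$
   Context: For positive integers $s_1,\dots,s_d$ with $s_1>1$, the multiple zeta value is $\zeta(s_1,\dots,s_d)=\sum_{k_1>\dots>k_d>0} k_1^{-s_1}\cdots k_d^{-s_d}$ (so the largest summation index carries the first exponent). All summation indices are integers. *)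

(* Defs.v *)
From mathcomp Require Import all_boot all_order all_algebra.
From mathcomp Require Import classical_sets reals constructive_ereal ereal esum.

Set Implicit Arguments.
Unset Strict Implicit.
Unset Printing Implicit Defensive.

Import Order.TTheory GRing.Theory Num.Theory.

Local Open Scope classical_set_scope.
Local Open Scope ring_scope.

(* The unordered sum of nonnegative terms over all k_1 > ... > k_d > 0.
   It is taken in \bar R; [fine] sends a divergent sum to 0, so [mzv] is
   meaningful only for positive exponents whose first one is at least 2. *)
Definition mzv (R : realType) (s : seq nat) : R :=
  fine (\esum_(k in [set k : (size s).-tuple nat |
                       sorted gtn k /\ all (fun x => 0 < x)%N k])
          (\prod_(i < size s) (tnth k i)%:R ^- tnth (in_tuple s) i)%:E).

(* Main.v *)
(** Put [L_a(k) = x / (k - a x)], a power series in [x] whose coefficient of [x^i]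
is [a^(i-1) / k^i]. Then the coefficient of [x^n] in the nested sum of
[L_a(k_1) L_b(k_2) ...] over [k_1 > k_2 > ...] is the sum of
[a^(i-1) b^(j-1) ... zeta(i, j, ...)] over [i + j + ... = n], so that both sides
of the theorem are coefficients of combinations of such sums with [a, b, ...] in
[{0, 1, 2}]. These sums satisfy double shuffle relations: the stuffle product comes
from [L_1(k) L_0(k) = L_1(k) - L_0(k)] and the shuffle product from
[L_a(k) L_b(l) = L_(a+b)(k+l) (L_a(k) + L_b(l))]. The theorem is a linear
combination of 22 of them, possibly multiplied by a further sum, up to words in
[L_0] alone, which are monomials of degree at most 4 in [x].

Many of the sums diverge logarithmically, so everything is truncated at
[k_1 <= N]. The stuffle product is then exact, while the shuffle product misses
the pairs with [k, l <= N < k + l]; when one factor is convergent their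
contribution is [O(log(N)^c / N)], coefficient by coefficient. *)
Require Import Defs.
From mathcomp Require Import all_boot all_order all_algebra.
From mathcomp Require Import reals.
From mathcomp Require Import qpoly.
From mathcomp Require Import all_classical ereal esum topology normedtype sequences.
From mathcomp Require Import ring lra zify.

Set Implicit Arguments.
Unset Strict Implicit.
Unset Printing Implicit Defensive.

Import Order.TTheory GRing.Theory Num.Theory.
Import numFieldNormedType.Exports.

Local Open Scope classical_set_scope.
Local Open Scope ring_scope.

(** * Words and the certificate *)

(* The letter [(a, m)] stands for the factor [L_a(k)^m]. *)
Definition letter : Type := (nat * nat)%type.
Definition word : Type := seq letter.
Definition lin (T : Type) : Type := seq (int * T).

Definition lscale T (c : int) (p : lin T) : lin T := [seq (c * x.1, x.2) | x <- p].
Definition lmap T U (f : T -> U) (p : lin T) : lin U := [seq (x.1, f x.2) | x <- p].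
Definition lbind T U (f : T -> lin U) (p : lin T) : lin U :=
  flatten [seq lscale x.1 (f x.2) | x <- p].

(* [parfrac b m k] expands [x_(b+1)^m x_b^k] by means of
   [x_(b+1) x_b = x_(b+1) - x_b]. *)
Fixpoint parfrac (b m : nat) : nat -> lin letter :=
  fix parfrac_m (k : nat) :=
    match m, k with
    | 0, _ => [:: (1, (b, k))]
    | _, 0 => [:: (1, (b.+1, m))]
    | m'.+1, k'.+1 => parfrac_m k' ++ lscale (-1) (parfrac b m' k)
    end.

(* Letters whose shifts differ by more than 1 get the junk value [::]. *)
Definition mul_letter (x y : letter) : lin letter :=
  if x.1 == y.1 then [:: (1, (x.1, x.2 + y.2)%N)]
  else if x.1 == y.1.+1 then parfrac y.1 x.2 y.2
  else if y.1 == x.1.+1 then parfrac x.1 y.2 x.2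
  else [::].

Fixpoint stuffle (u : word) : word -> lin word :=
  fix stuffle_u (v : word) :=
    match u, v with
    | [::], _ => [:: (1, v)]
    | _, [::] => [:: (1, u)]
    | x :: u', y :: v' =>
      lmap (cons x) (stuffle u' v) ++ lmap (cons y) (stuffle_u v')
      ++ lbind (fun l => lmap (cons l) (stuffle u' v')) (mul_letter x y)
    end.

Definition raise_head (w : word) : word :=
  if w is (a, m) :: w' then (a, m.+1) :: w' else [::].

(* A leading exponent 0 stands for a summation variable without factor. *)
Fixpoint shuffle_rec (fuel : nat) (u v : word) : lin word :=
  if fuel isn't fuel'.+1 then [::] else
  match u, v with
  | [::], _ => [:: (1, v)]
  | _, [::] => [:: (1, u)]
  | (a, 0) :: u', (b, _) :: _ => lmap (cons (a + b, 0)%N) (shuffle_rec fuel' u' v)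
  | (a, _) :: _, (b, 0) :: v' => lmap (cons (a + b, 0)%N) (shuffle_rec fuel' u v')
  | (a, m.+1) :: u', (b, k.+1) :: v' =>
    lmap raise_head (shuffle_rec fuel' ((a, m) :: u') v
                     ++ shuffle_rec fuel' u ((b, k) :: v'))
  end.

(** A letter counts one more than its exponent, so that both kinds of recursive call of
    [shuffle_rec] decrease the measure: lowering an exponent, and dropping a letter of exponent
    0. *)
Definition wsize (w : word) : nat := sumn [seq x.2.+1 | x <- w].
Definition shuffle (u v : word) : lin word := shuffle_rec (wsize u + wsize v).+1 u v.

Definition adjacent (x y : letter) : bool := (x.1 <= y.1.+1)%N && (y.1 <= x.1.+1)%N.

Definition adjacent_words (u v : word) : bool := all (fun x => all (adjacent x) v) u.

Definition positive_word (w : word) : bool := all (fun x => 0 < x.2)%N w.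

Definition defect (u v : word) : lin word := stuffle u v ++ lscale (-1) (shuffle u v).

(* A leading letter (1, 1) makes the sum over the largest index diverge
   logarithmically; subtracting the word with leading letter (0, 1) cures this. *)
Definition reg_defect (x : letter) (u v : word) : lin word :=
  if x == (1, 1)%N then defect ((1, 1)%N :: u) v ++ lscale (-1) (defect ((0, 1)%N :: u) v)
  else defect (x :: u) v.

(* [Relation c x u v w] is [c] times the (regularized) double shuffle relation of
   [x :: u] and [v], multiplied by the sum attached to [w]. *)
Record relation := Relation {
  rel_coef : int; rel_head : letter; rel_tail : word; rel_right : word; rel_factor : word }.

Definition rel_lin (r : relation) : lin word :=
  lscale (rel_coef r) (lbind (fun t => stuffle t (rel_factor r))
                         (reg_defect (rel_head r) (rel_tail r) (rel_right r))).

Definition rel_valid (r : relation) : bool :=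
  let: Relation _ x u v w := r in
  [&& (x == (1, 1)%N) || (1 < x.2)%N, v != [::],
    positive_word u, positive_word v, positive_word w,
    adjacent_words (x :: u) v, adjacent_words ((0, 1)%N :: u) v
    & all (fun t => adjacent_words t.2 w) (reg_defect x u v)].

Fixpoint linsert (T : eqType) (c : int) (x : T) (p : lin T) : lin T :=
  if p is (d, y) :: q then
    if x == y then (c + d, y) :: q else (d, y) :: linsert c x q
  else [:: (c, x)].

Definition lcollect (T : eqType) (p : lin T) : lin T :=
  foldr (fun x => linsert x.1 x.2) [::] p.

Local Notation L01 := (0, 1)%N.
Local Notation L02 := (0, 2)%N.
Local Notation L03 := (0, 3)%N.
Local Notation L11 := (1, 1)%N.
Local Notation L12 := (1, 2)%N.
Local Notation L21 := (2, 1)%N.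

(* Its coefficient of [x^n] is twice the difference of the two sides of the theorem
   (see [target_lin_gap]). *)
Definition target_lin : lin word :=
  [:: (4, [:: L11; L01; L11; L11]); (- 4, [:: L01; L01; L11; L11]);
      (- 2, [:: L21; L11; L11; L11]); (2, [:: L01; L11; L11; L11]);
      (- 4, [:: L11; L11; L21; L11]); (4, [:: L01; L11; L21; L11]);
      (- 2, [:: L12; L01; L11]); (- 2, [:: L11; L01; L11]); (2, [:: L01; L01; L11]);
      (- 4, [:: L02; L11]); (- 2, [:: L12; L02]);
      (4, [:: L12; L01]); (- 2, [:: L11; L01]); (1, [:: L12]); (6, [:: L11])].

(* Found by linear algebra over all relations among words of degree at most 4. *)
Definition certificate : seq relation :=
  [:: Relation (-2) L02 [::] [:: L11] [::];
      Relation 1 L12 [::] [:: L02] [::];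
      Relation (-2) L12 [:: L01] [:: L01] [::];
      Relation 14 L11 [::] [:: L11; L01; L01] [::];
      Relation (-2) L11 [::] [:: L11; L11; L11] [::];
      Relation 1 L11 [:: L11] [:: L11; L11] [::];
      Relation (-2) L11 [::] [:: L03] [::];
      Relation 1 L11 [:: L11] [:: L01; L11] [::];
      Relation 2 L11 [::] [:: L01; L01; L11] [::];
      Relation 2 L11 [:: L11; L11] [:: L01] [::];
      Relation 6 L11 [:: L11] [:: L01] [::];
      Relation (-8) L11 [:: L11] [:: L01; L01] [::];
      Relation 4 L11 [::] [:: L01] [::];
      Relation (-14) L11 [::] [:: L01; L01] [:: L01];
      Relation 12 L11 [:: L01; L01] [:: L01] [::];
      Relation 12 L11 [::] [:: L01] [:: L01; L01];
      Relation 6 L11 [:: L11] [:: L01] [:: L01];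
      Relation (-10) L11 [:: L01; L01] [:: L11] [::];
      Relation 8 L11 [::] [:: L01] [:: L02];
      Relation 2 L11 [::] [:: L01] [:: L11; L01];
      Relation (-2) L11 [:: L01] [:: L11; L01] [::];
      Relation 2 L11 [:: L01] [:: L01] [:: L01]].

(** A word in the letters of shift 0 is a monomial in $x$ whose degree is the sum of its exponents;
    below degree 5 it cannot contribute to the coefficient of $x^n$ for $n\ge 5$. *)
Definition negligible (c : int) (w : word) : bool :=
  (c == 0) || (all (fun x => x.1 == 0%N) w && (sumn (map snd w) < 5)%N).

Lemma certificate_valid : all rel_valid certificate.
Proof. by vm_compute. Qed.

(** The finite computation on which the theorem rests; it is purely symbolic and independent of
    $n$. *)
Lemma certificateP :
  all (fun x => negligible x.1 x.2)
    (lcollect (target_lin ++ lscale (-1) (flatten (map rel_lin certificate)))).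
Proof. by vm_compute. Qed.

(** * Double shuffle relations for truncated sums *)

Section Gauge.

Variable R : realFieldType.

(* Grows like [N^(1/16)]: a substitute for all powers of logarithms. *)
Definition gauge (N : nat) : R := \prod_(j < N) (1 + (16 * j.+1%:R)^-1).

Lemma gauge0 : gauge 0 = 1.
Proof. exact: big_ord0. Qed.

Lemma gaugeS N : gauge N.+1 = gauge N + gauge N / (16 * N.+1%:R).
Proof. by rewrite /gauge big_ord_recr /= mulrDr mulr1. Qed.

Lemma gauge_ge1 N : 1 <= gauge N.
Proof.
elim: N => [|N IHN]; first by rewrite gauge0.
rewrite gaugeS (le_trans IHN) // lerDl divr_ge0 // ?mulr_ge0 //.
exact: le_trans ler01 IHN.
Qed.

Lemma gauge_gt0 N : 0 < gauge N.
Proof. exact: lt_le_trans ltr01 (gauge_ge1 N). Qed.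

Lemma gauge_ge0 N : 0 <= gauge N.
Proof. exact/ltW/gauge_gt0. Qed.

Lemma gauge_mono : {homo gauge : m n / (m <= n)%N >-> m <= n}.
Proof.
apply: homo_leq => [x|y x z|N]; [exact: lexx|exact: le_trans|].
by rewrite gaugeS lerDl divr_ge0 ?mulr_ge0 ?gauge_ge0.
Qed.

(** Telescoping, by [gaugeS]. Thus summation against $1/k$ reproduces the gauge up to a constant,
    where a logarithm would gain a power each time. *)
Lemma sum_gauge N : \sum_(k < N) gauge k / k.+1%:R = 16 * (gauge N - 1).
Proof.
elim: N => [|N IHN]; first by rewrite big_ord0 gauge0 subrr mulr0.
have N0 : N.+1%:R != 0 :> R by rewrite pnatr_eq0.
by rewrite big_ord_recr /= IHN gaugeS; move: N.+1%:R N0 => t t0; field.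
Qed.

(** The exponent 8 is what [gauge_ratio_cvg0] needs: the square of $g^4/(N+1)$ is $g^8/(N+1)^2\le
    1/(N+1)$. *)
Lemma gauge_pow8 N : gauge N ^+ 8 <= N.+1%:R.
Proof.
elim: N => [|N IHN]; first by rewrite gauge0 expr1n.
rewrite gaugeS -[X in X + _]mulr1 -mulrDr exprMn.
have N0 : 0 < N.+1%:R :> R by rewrite ltr0n.
set y := (16 * N.+1%:R)^-1.
have y0 : 0 <= y by rewrite invr_ge0 mulr_ge0.
have y1 : y <= 16^-1.
  by rewrite lef_pV2 ?posrE ?mulr_gt0 // ler_peMr // ler1n.
have -> : N.+2%:R = N.+1%:R * (1 + 16 * y) :> R.
  by rewrite /y [N.+2%:R]mulrSr; move: N.+1%:R N0 => t t0; field; rewrite gt_eqF.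
apply: ler_pM => //; first by rewrite exprn_ge0 ?gauge_ge0.
  by rewrite exprn_ge0 ?addr_ge0.
(* The goal is now $(1+y)^8\le 1+16y$ for $0\le y\le 1/16$, obtained by squaring three times and
   absorbing $y^2\le y/16$ each time. *)
have e2 : (1 + y) ^+ 2 <= 1 + 33 / 16 * y by nra.
have e4 : (1 + y) ^+ 4 <= 1 + 5 * y.
  rewrite -[4%N]/(2 * 2)%N exprM (le_trans (lerXn2r 2 _ _ e2)) ?nnegrE ?sqr_ge0 //.
    by lra.
  nra.
rewrite -[8%N]/(4 * 2)%N exprM (le_trans (lerXn2r 2 _ _ e4)) ?nnegrE ?exprn_ge0 //; lra.
Qed.

(** The subtracted term makes the induction go through: its decrease from $N$ to $N+1$ dominates the
    new summand. *)
Lemma sum_gauge_sqr N : \sum_(k < N) gauge k / k.+1%:R ^+ 2 <= 3 - 3 * gauge N / N.+1%:R.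
Proof.
elim: N => [|N IHN]; first by rewrite big_ord0 gauge0; lra.
rewrite big_ord_recr /= gaugeS (le_trans (lerD IHN (lexx _))) //.
have g0 := gauge_ge0 N; rewrite [N.+2%:R]mulrSr.
have t1 : 1 <= N.+1%:R :> R by rewrite ler1n.
set t : R := N.+1%:R in t1 *; set g := gauge N in g0 *.
clearbody t g; have t0 : 0 < t by lra.
rewrite -subr_ge0.
have -> : 3 - 3 * (g + g / (16 * t)) / (t + 1) - (3 - 3 * g / t + g / t ^+ 2)
  = g * (29 * t - 16) / (16 * t ^+ 2 * (t + 1)).
  by field; rewrite !gt_eqF ?addr_gt0.
rewrite divr_ge0 ?mulr_ge0 ?exprn_ge0 //; lra.
Qed.

End Gauge.

(** * Exact stuffle and shuffle identities over an abstract commutative ring *)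

Section DoubleShuffle.

Variables (A : comNzRingType) (lam : nat -> nat -> A).

(** For $L_a(k)=x/(k-ax)$ the formal reciprocal is $k/x-a$. The two hypotheses say that reciprocals
    of consecutive shifts differ by 1 and that reciprocals add when indices and shifts add. *)
Hypothesis lam_adj : forall a k, lam a.+1 k.+1 * lam a k.+1 = lam a.+1 k.+1 - lam a k.+1.
Hypothesis lam_mul : forall a b k l,
  lam a k.+1 * lam b l.+1 = lam (a + b) (k.+1 + l.+1)%N * (lam a k.+1 + lam b l.+1).

Definition mon (x : letter) (k : nat) : A := lam x.1 k ^+ x.2.

(** The bound variable [k] stands for the index $k+1\le N$, so the remaining indices, at most $k$,
    are strictly smaller. *)
Fixpoint wsum (w : word) (N : nat) : A :=
  if w is x :: w' then \sum_(k < N) mon x k.+1 * wsum w' k else 1.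

(** The part of [wsum] whose largest index is exactly $k+1$. *)
Definition wterm (w : word) (k : nat) : A :=
  if w is x :: w' then mon x k.+1 * wsum w' k else 0.

Definition lev T (f : T -> A) (p : lin T) : A := \sum_(x <- p) x.1%:~R * f x.2.

Lemma lev_nil T (f : T -> A) : lev f [::] = 0.
Proof. exact: big_nil. Qed.

Lemma lev_cons T (f : T -> A) x p : lev f (x :: p) = x.1%:~R * f x.2 + lev f p.
Proof. exact: big_cons. Qed.

Lemma lev1 T (f : T -> A) x : lev f [:: (1, x)] = f x.
Proof. by rewrite /lev big_seq1 mul1r. Qed.

Lemma lev_cat T (f : T -> A) p q : lev f (p ++ q) = lev f p + lev f q.
Proof. exact: big_cat. Qed.

Lemma lev_scale T (f : T -> A) c p : lev f (lscale c p) = c%:~R * lev f p.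
Proof.
by rewrite /lev big_map mulr_sumr; apply: eq_bigr => x _; rewrite intrM mulrA.
Qed.

Lemma lev_opp T (f : T -> A) p : lev f (lscale (-1) p) = - lev f p.
Proof. by rewrite lev_scale mulN1r. Qed.

Lemma lev_map T U (f : U -> A) (g : T -> U) p : lev f (lmap g p) = lev (f \o g) p.
Proof. by rewrite /lev big_map. Qed.

Lemma lev_bind T U (f : U -> A) (g : T -> lin U) p :
  lev f (lbind g p) = lev (fun x => lev f (g x)) p.
Proof.
rewrite /lev /lbind big_flatten big_map; apply: eq_bigr => x _.
exact: lev_scale.
Qed.

Lemma eq_lev T (f g : T -> A) p : f =1 g -> lev f p = lev g p.
Proof. by move=> fg; apply: eq_bigr => x _; rewrite fg. Qed.

Lemma lev_mull T (f : T -> A) c p : lev (fun x => c * f x) p = c * lev f p.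
Proof. by rewrite /lev mulr_sumr; apply: eq_bigr => x _; rewrite mulrCA. Qed.

Lemma lev_mulr T (f : T -> A) c p : lev (fun x => f x * c) p = lev f p * c.
Proof. by rewrite /lev mulr_suml; apply: eq_bigr => x _; rewrite mulrA. Qed.

Lemma lev_add T (f g : T -> A) p : lev (fun x => f x + g x) p = lev f p + lev g p.
Proof. by rewrite /lev -big_split; apply: eq_bigr => x _; rewrite mulrDr. Qed.

Lemma lev_sum T (f : nat -> T -> A) N p :
  lev (fun x => \sum_(k < N) f k x) p = \sum_(k < N) lev (f k) p.
Proof.
by rewrite /lev exchange_big; apply: eq_bigr => x _; rewrite mulr_sumr.
Qed.

(** One product $xy$ is split off $x^{m+1}y^{k+1}$ and replaced by $x-y$, which leaves
    $x^{m+1}y^k-x^my^{k+1}$. *)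
Lemma parfracE b m k j :
  lev (mon^~ j.+1) (parfrac b m k) = lam b.+1 j.+1 ^+ m * lam b j.+1 ^+ k.
Proof.
elim: m k => [|m IHm] k; first by case: k => [|k]; rewrite lev1 ?mul1r.
elim: k => [|k IHk]; first by rewrite lev1 mulr1.
rewrite /= lev_cat lev_opp IHk IHm.
have := lam_adj b j; set x := lam _ _; set y := lam _ _ => xy.
have -> : x ^+ m.+1 * y ^+ k.+1 = x * y * (x ^+ m * y ^+ k).
  by rewrite !exprS; ring.
by rewrite xy !exprS; ring.
Qed.

Lemma mul_letterE x y j : adjacent x y ->
  lev (mon^~ j.+1) (mul_letter x y) = mon x j.+1 * mon y j.+1.
Proof.
case: x y => [a m] [b k]; rewrite /adjacent /mul_letter /mon /=.
case: (eqVneq a b) => [->|ab] /=; first by rewrite lev1 /= exprD.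
case: (eqVneq a b.+1) => [->|ab1] /=; first by rewrite parfracE.
case: (eqVneq b a.+1) => [->|ba1] /=; first by rewrite parfracE mulrC.
lia.
Qed.

Lemma wsumS x w N : wsum (x :: w) N.+1 = wsum (x :: w) N + mon x N.+1 * wsum w N.
Proof. by rewrite /= big_ord_recr. Qed.

Lemma lev_wsumS (x : letter) p N :
  lev (wsum^~ N.+1) (lmap (cons x) p) =
  lev (wsum^~ N) (lmap (cons x) p) + mon x N.+1 * lev (wsum^~ N) p.
Proof.
rewrite !lev_map -lev_mull -lev_add; apply: eq_lev => w /=.
by rewrite big_ord_recr.
Qed.

Lemma wsum_cons0 x w : wsum (x :: w) 0 = 0.
Proof. exact: big_ord0. Qed.

Lemma lev_wsum0 (x : letter) p : lev (wsum^~ 0) (lmap (cons x) p) = 0.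
Proof.
rewrite lev_map /lev big1 // => i _.
by rewrite /comp wsum_cons0 mulr0.
Qed.

Lemma stuffle_cons x u y v : stuffle (x :: u) (y :: v) =
  lmap (cons x) (stuffle u (y :: v)) ++ lmap (cons y) (stuffle (x :: u) v)
  ++ lbind (fun l => lmap (cons l) (stuffle u v)) (mul_letter x y).
Proof. by []. Qed.

(** Inductions on both words, then on [N]. Passing to $N+1$ turns $PQ$ into $(P+p)(Q+q)$; the new
    products $pQ$, $Pq$ and $pq$ are the increments of the three branches of [stuffle], according to
    which word holds the largest index. *)
Lemma stuffleE u v N : adjacent_words u v ->
  lev (wsum^~ N) (stuffle u v) = wsum u N * wsum v N.
Proof.
elim: u v N => [|x u IHu] v N; first by case: v => [|y v]; rewrite lev1 mul1r.
elim: v N => [|y v IHv] N; first by rewrite lev1 mulr1.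
move=> adj.
have [xy xv uyv] : [/\ adjacent x y, all (adjacent x) v
    & all (fun z => all (adjacent z) (y :: v)) u] by case/andP: adj => /andP[].
have uv : all (fun z => all (adjacent z) v) u.
  by apply: sub_all uyv => z /= /andP[].
have xuv : all (fun z => all (adjacent z) v) (x :: u) by rewrite /= xv.
rewrite stuffle_cons !lev_cat lev_bind.
elim: N => [|N IHN].
  rewrite !lev_wsum0 wsum_cons0 mul0r /lev big1 ?addr0 // => i _.
  by rewrite [X in _ * X]lev_wsum0 mulr0.
rewrite !lev_wsumS IHu // IHv //.
rewrite (eq_lev _ (fun l => lev_wsumS l (stuffle u v) N)) IHu //.
rewrite lev_add lev_mulr mul_letterE // !wsumS.
set P := lev _ _ in IHN *; set Q := lev _ _ in IHN *; set S := lev _ _ in IHN *.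
have -> : P = wsum (x :: u) N * wsum (y :: v) N - Q - S.
  by rewrite -IHN; ring.
ring.
Qed.

(** Positions [i] and [c - i.+1] stand for the indices $i+1$ and $c-i$, whose sum $c+1$ is the index
    at position [c]. *)
Definition conv (f g : nat -> A) (c : nat) : A := \sum_(i < c) f i * g (c - i.+1)%N.

Lemma convC (f g : nat -> A) : conv f g =1 conv g f.
Proof.
move=> c; rewrite /conv (reindex_inj rev_ord_inj) /=.
apply: eq_bigr => i _; rewrite mulrC; congr (g _ * f _).
have := ltn_ord i; lia.
Qed.

(** On generating functions, strict partial summation is multiplication by $t/(1-t)$, which commutes
    with products. *)
Lemma conv_psum (f g : nat -> A) c :
  conv (fun i => \sum_(j < i) f j) g c = \sum_(d < c) conv f g d.
Proof.
elim: c => [|c IHc]; first by rewrite /conv !big_ord0.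
rewrite big_ord_recr /= -IHc /conv big_ord_recl big_ord0 mul0r add0r -big_split.
apply: eq_bigr => i _; rewrite lift0 big_ord_recr /= mulrDl.
by rewrite subSS.
Qed.

Definition wconv (u v : word) (c : nat) : A := conv (wterm u) (wterm v) c.

Lemma wterm0 a w : wterm ((a, 0) :: w) =1 wsum w.
Proof. by move=> k; rewrite /= /mon expr0 mul1r. Qed.

Lemma shuffle_rec0l n v : shuffle_rec n.+1 [::] v = [:: (1, v)].
Proof. by case: v => [|[b []]]. Qed.

Lemma shuffle_rec0r n u : shuffle_rec n.+1 u [::] = [:: (1, u)].
Proof. by case: u => [|[a []]]. Qed.

(** This keeps [raise_head] away from its default value, and identifies it as multiplication by
    $L_{a+b}$ at the largest index. *)
Lemma shuffle_rec_head n x u y v w :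
  w \in [seq z.2 | z <- shuffle_rec n (x :: u) (y :: v)] ->
  exists k w', w = ((x.1 + y.1)%N, k) :: w'.
Proof.
elim: n x u y v w => [//|n IHn] [a m] u [b k] v w /=.
case: m k => [|m] [|k]; rewrite -map_comp /=; try by
  move=> /mapP [z _ ->] /=; eexists; eexists.
move=> /mapP [z]; rewrite mem_cat => /orP[] zin -> /=.
  have [|k' [w' ->]] := IHn (a, m) u (b, k.+1) v z.2; first exact: map_f.
  by eexists; eexists.
have [|k' [w' ->]] := IHn (a, m.+1) u (b, k) v z.2; first exact: map_f.
by eexists; eexists.
Qed.

Lemma lev_raise_head a p c :
  (forall w, w \in [seq z.2 | z <- p] -> exists k w', w = (a, k) :: w') ->
  lev (wterm^~ c) (lmap raise_head p) = lam a c.+1 * lev (wterm^~ c) p.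
Proof.
move=> hp; rewrite lev_map -lev_mull /lev; apply: eq_big_seq => z zp.
have [|k [w' ->]] := hp z.2; first exact: map_f.
by rewrite /= /mon exprS mulrA.
Qed.

Lemma lev_wsum_wterm p N : all (fun z => z.2 != [::]) p ->
  lev (wsum^~ N) p = \sum_(c < N) lev (wterm^~ c) p.
Proof.
move=> hp; rewrite -(lev_sum (fun k w => wterm w k)) /lev; apply: eq_big_seq => z zp.
by have := allP hp z zp; case: z.2.
Qed.

(** With leading indices $k+l=c+1$ fixed, [lam_mul] trades one factor $L_a(k)L_b(l)$ for
    $L_{a+b}(c+1)$ and a lower power of one of the two. Once an exponent reaches 0, its index only
    bounds the rest of its word, and summing over it gives a shuffle of the remaining words with a
    smaller largest index. *)
Lemma shuffle_recE n x u y v c : (wsize (x :: u) + wsize (y :: v) < n)%N ->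
  lev (wterm^~ c) (shuffle_rec n (x :: u) (y :: v)) = wconv (x :: u) (y :: v) c.
Proof.
elim: n x u y v c => [//|n IHn] [a m] u [b k] v c; rewrite /wsize /= => hn.
have IHsum u' v' N : u' != [::] -> v' != [::] -> (wsize u' + wsize v' < n)%N ->
    lev (wsum^~ N) (shuffle_rec n u' v') = \sum_(d < N) wconv u' v' d.
  case: u' v' => [//|x u'] [//|y v'] _ _ hn'; rewrite lev_wsum_wterm.
    by apply: eq_bigr => d _; rewrite IHn.
  apply/allP => z zin.
  by have [|k' [w' ->]] := @shuffle_rec_head n x u' y v' z.2; first exact: map_f.
have nil1 w : \sum_(i < c) wterm w i = conv (wsum [::]) (wterm w) c.
  rewrite (reindex_inj rev_ord_inj) /=.
  by apply: eq_bigr => i _; rewrite mul1r.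
(* Behind a leading exponent 0, [wterm] is a partial sum, so [conv_psum] applies; an empty remainder
   is handled by [nil1]. *)
have zero u' y' v' : (wsize u' + wsize (y' :: v') < n)%N ->
    lev (wsum^~ c) (shuffle_rec n u' (y' :: v'))
    = conv (wsum u') (wterm (y' :: v')) c.
  case: u' => [|x' u'] hn'; last by rewrite IHsum // -conv_psum.
  by rewrite -nil1; case: n hn' {IHn hn IHsum} => // n _; rewrite shuffle_rec0l lev1.
have zero' u' y' v' : (wsize u' + wsize (y' :: v') < n)%N ->
    lev (wsum^~ c) (shuffle_rec n (y' :: v') u')
    = conv (wsum u') (wterm (y' :: v')) c.
  case: u' => [|x' u'] hn'.
    rewrite -nil1; case: n hn' {IHn hn IHsum zero} => // n _.
    by rewrite shuffle_rec0r lev1.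
  rewrite IHsum // 1?addnC //.
  by under eq_bigr do rewrite /wconv convC; rewrite -conv_psum.
have head0 s p : lev (wterm^~ c) (lmap (cons (s, 0)) p) = lev (wsum^~ c) p.
  by rewrite lev_map; apply: eq_lev => w; rewrite /comp wterm0.
case: m hn => [|m] hn.
  rewrite head0 zero; last by rewrite /wsize /=; lia.
  by apply: eq_bigr => i _; rewrite wterm0.
case: k hn => [|k] hn.
  rewrite head0 zero'; last by rewrite /wsize /=; lia.
  by rewrite /wconv convC; apply: eq_bigr => i _; rewrite wterm0.
rewrite (@lev_raise_head (a + b)); last first.
  by move=> w; rewrite map_cat mem_cat => /orP[] /shuffle_rec_head.
rewrite lev_cat !IHn; try by rewrite /wsize /=; lia.
rewrite /wconv /conv -big_split mulr_sumr; apply: eq_bigr => i _ /=.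
have ci : ((c - i.+1).+1 + i.+1 = c.+1)%N by have := ltn_ord i; lia.
have := lam_mul a b i (c - i.+1); rewrite [(_ + _.+1)%N]addnC ci => lamE.
rewrite /mon /= !exprS; move: lamE; set p := lam a _; set q := lam b _.
move=> lamE.
transitivity (p * q * (p ^+ m * wsum u i * (q ^+ k * wsum v (c - i.+1)))).
  by rewrite lamE; ring.
by ring.
Qed.

(** The shuffle covers exactly the pairs of leading indices $k,l$ with $k+l\le N$, here $k=i+1$. *)
Lemma shuffleE x u y v N :
  lev (wsum^~ N) (shuffle (x :: u) (y :: v)) =
  \sum_(i < N) wterm (x :: u) i * wsum (y :: v) (N - i.+1).
Proof.
rewrite lev_wsum_wterm; last first.
  apply/allP => z zin.
  by have [k [w ->]] := shuffle_rec_head (map_f _ zin).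
under eq_bigr do rewrite shuffle_recE //.
under eq_bigr do rewrite /wconv convC.
by rewrite -conv_psum -/(conv _ _ _) convC.
Qed.

(** * Norm bounds for the failure of the truncated shuffle relations *)

Variables (R : realFieldType) (nrm : A -> R).

Hypothesis nrm0 : nrm 0 = 0.
Hypothesis nrm1 : nrm 1 = 1.
Hypothesis nrmN : forall x, nrm (- x) = nrm x.
Hypothesis nrmD : forall x y, nrm (x + y) <= nrm x + nrm y.
Hypothesis nrmM : forall x y, nrm (x * y) <= nrm x * nrm y.
Hypothesis lam_bound : forall a, exists2 C, 0 <= C & forall k, nrm (lam a k.+1) <= C / k.+1%:R.

Lemma nrm_ge0 x : 0 <= nrm x.
Proof. by have := nrmD x (- x); rewrite nrmN subrr nrm0; lra. Qed.

Hint Resolve nrm_ge0 : core.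

Lemma nrm_sum (I : Type) (r : seq I) (P : pred I) (F : I -> A) :
  nrm (\sum_(i <- r | P i) F i) <= \sum_(i <- r | P i) nrm (F i).
Proof.
elim/big_rec2: _ => [|i y x _ xy]; first by rewrite nrm0.
exact: le_trans (nrmD _ _) (lerD _ xy).
Qed.

Lemma nrm_int c x : nrm (c%:~R * x) <= `|c|%:~R * nrm x.
Proof.
have nat_case n : nrm (n%:R * x) <= n%:R * nrm x.
  elim: n => [|n IHn]; first by rewrite !mul0r nrm0.
  by rewrite !mulrSr !mulrDl !mul1r (le_trans (nrmD _ _)) ?lerD.
case: c => n; first exact: nat_case.
by rewrite NegzE normrN mulrNz mulNr nrmN; exact: nat_case.
Qed.

Lemma lam_pow_bound a m : exists2 C, 0 <= C &
  forall k, nrm (lam a k.+1 ^+ m) <= C / k.+1%:R ^+ m.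
Proof.
have [C C0 hC] := lam_bound a; elim: m => [|m [D D0 hD]].
  by exists 1 => // k; rewrite !expr0 nrm1 divr1.
exists (C * D); first exact: mulr_ge0.
move=> k; rewrite !exprS invfM mulrACA (le_trans (nrmM _ _)) //.
exact: ler_pM.
Qed.

Lemma mon_bound x : (0 < x.2)%N ->
  exists2 C, 0 <= C & forall k, nrm (mon x k.+1) <= C / k.+1%:R.
Proof.
case: x => a [//|m] _; have [C C0 hC] := lam_pow_bound a m.+1.
exists C => // k; rewrite (le_trans (hC k)) // ler_wpM2l // lef_pV2 ?posrE ?exprn_gt0 //.
by rewrite ler_eXnr // ler1n.
Qed.

(** By [sum_gauge], every further letter costs a constant only, so one power of the gauge serves all
    depths. *)
Lemma wsum_bound w : positive_word w ->
  exists2 C, 0 <= C & forall N, nrm (wsum w N) <= C * gauge R N.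
Proof.
elim: w => [|x w IHw] /=; first by exists 1 => // N; rewrite nrm1 mul1r gauge_ge1.
move=> /andP[/mon_bound [C C0 hC] /IHw [D D0 hD]].
exists (C * D * 16); first by rewrite !mulr_ge0.
move=> N; rewrite (le_trans (nrm_sum _ _ _)) //.
apply: (@le_trans _ _ (\sum_(k < N) C * D * (gauge R k / k.+1%:R))).
  apply: ler_sum => k _; rewrite (le_trans (nrmM _ _)) //.
  by rewrite -mulrA [D * _]mulrA [D * _ / _]mulrC mulrA ler_pM.
rewrite -mulr_sumr sum_gauge mulrA ler_wpM2l ?mulr_ge0 //.
by rewrite lerBlDr lerDl ler01.
Qed.

Lemma wsum_tail_bound y v : positive_word (y :: v) -> exists2 C, 0 <= C &
  forall N M, (M <= N)%N ->
    nrm (wsum (y :: v) N - wsum (y :: v) M) <= C * gauge R N * ((N - M)%:R / M.+1%:R).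
Proof.
move=> /= /andP[/mon_bound [C C0 hC] /wsum_bound [D D0 hD]].
exists (C * D); first exact: mulr_ge0.
move=> N M MN; rewrite /= -!(big_mkord xpredT (fun k => mon y k.+1 * wsum v k)).
rewrite (@big_cat_nat _ _ _ M) //= addrAC subrr add0r.
rewrite (le_trans (nrm_sum _ _ _)) //.
apply: (@le_trans _ _ (\sum_(M <= k < N) C * D * gauge R N / M.+1%:R)); last first.
  by rewrite sumr_const_nat -[_ *+ _]mulr_natr -mulrA [_^-1 * _]mulrC.
apply: ler_sum_nat => k /andP[Mk kN]; rewrite (le_trans (nrmM _ _)) //.
have -> : C * D * gauge R N / M.+1%:R = C / M.+1%:R * (D * gauge R N) by ring.
apply: ler_pM => //.
  rewrite (le_trans (hC k)) // ler_wpM2l // lef_pV2 ?posrE //.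
  by rewrite ler_nat.
rewrite (le_trans (hD k)) // ler_wpM2l //.
exact/gauge_mono/ltnW.
Qed.

Lemma sum_inv_bound N : \sum_(k < N) k.+1%:R^-1 <= 16 * gauge R N.
Proof.
apply: (@le_trans _ _ (\sum_(k < N) gauge R k / k.+1%:R)).
  by apply: ler_sum => k _; rewrite ler_peMl ?invr_ge0 ?gauge_ge1.
by rewrite sum_gauge ler_wpM2l // lerBlDr lerDl ler01.
Qed.

(** Partial fractions: since $(i+1)+(N-i)=N+1$, the summand is $\bigl(1/(i+1)+1/(N-i)\bigr)/(N+1)$,
    and both halves are the same harmonic sum. *)
Lemma sum_inv_refl N :
  \sum_(i < N) (i.+1%:R * (N - i)%:R)^-1 <= 32 * gauge R N / N.+1%:R.
Proof.
have -> : \sum_(i < N) (i.+1%:R * (N - i)%:R)^-1 =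
    \sum_(i < N) (i.+1%:R^-1 + (N - i)%:R^-1) / N.+1%:R :> R.
  apply: eq_bigr => i _.
  have Ni : (N.+1 = i.+1 + (N - i))%N by have := ltn_ord i; lia.
  have i0 : 0 < i.+1%:R :> R by [].
  have Ni0 : 0 < (N - i)%:R :> R by rewrite ltr0n subn_gt0.
  rewrite Ni natrD; move: (i.+1%:R : R) ((N - i)%:R : R) i0 Ni0 => s t s0 t0.
  by field; rewrite !gt_eqF ?addr_gt0.
rewrite -mulr_suml big_split /= ler_wpM2r ?invr_ge0 //.
rewrite [X in _ + X](reindex_inj rev_ord_inj) /=.
have -> : \sum_(j < N) (N - (N - j.+1))%:R^-1 = \sum_(j < N) j.+1%:R^-1 :> R.
  by apply: eq_bigr => j _; rewrite subKn.
have := sum_inv_bound N; lra.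
Qed.

(** The difference of the two [wsum] has $i+1$ terms of order $1/(N-i)$. Against the decay
    $(i+1)^{-2}$ of [f] this leaves $1/((i+1)(N-i))$. The gauge enters once for [u], once for the
    tail and once for [sum_inv_refl]. *)
Lemma defect_bound (f : nat -> A) C u y v : 0 <= C ->
  (forall k, nrm (f k) <= C / k.+1%:R ^+ 2) ->
  positive_word u -> positive_word (y :: v) ->
  exists2 D, 0 <= D & forall N,
    nrm (\sum_(i < N) f i * wsum u i
           * (wsum (y :: v) N - wsum (y :: v) (N - i.+1)))
    <= D * (gauge R N ^+ 3 / N.+1%:R).
Proof.
move=> C0 hf /wsum_bound [D D0 hD] /wsum_tail_bound [E E0 hE].
exists (C * D * E * 32); first by rewrite !mulr_ge0.
move=> N; rewrite (le_trans (nrm_sum _ _ _)) //.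
have -> : C * D * E * 32 * (gauge R N ^+ 3 / N.+1%:R)
  = C * D * E * gauge R N ^+ 2 * (32 * gauge R N / N.+1%:R) by ring.
apply: le_trans (ler_wpM2l _ (sum_inv_refl N)); last by rewrite ?mulr_ge0 ?gauge_ge0 ?sqr_ge0.
rewrite mulr_sumr; apply: ler_sum => i _.
have Ni : (N - i = (N - i.+1).+1)%N by have := ltn_ord i; lia.
have Ni' : (N - (N - i.+1) = i.+1)%N by have := ltn_ord i; lia.
have Ni0 : 0 < (N - i)%:R :> R by rewrite ltr0n subn_gt0.
have i0 : 0 < i.+1%:R :> R by [].
have -> : C * D * E * gauge R N ^+ 2 / (i.+1%:R * (N - i)%:R)
  = C / i.+1%:R ^+ 2 * (D * gauge R N) * (E * gauge R N * (i.+1%:R / (N - i)%:R)).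
  move: (i.+1%:R : R) ((N - i)%:R : R) i0 Ni0 => s t s0 t0.
  by field; rewrite !gt_eqF.
rewrite (le_trans (nrmM _ _)) //; apply: ler_pM => //.
  rewrite (le_trans (nrmM _ _)) //; apply: ler_pM => //.
  rewrite (le_trans (hD i)) // ler_wpM2l //.
  exact/gauge_mono/ltnW.
by have := hE N (N - i.+1)%N (leq_subr _ _); rewrite Ni' -Ni.
Qed.

Lemma lev_linsert (T : eqType) (f : T -> A) c x p :
  lev f (linsert c x p) = c%:~R * f x + lev f p.
Proof.
elim: p => [|[d y] p IHp]; first exact: lev_cons.
rewrite /=; case: eqVneq => [->|_]; rewrite !lev_cons /=.
  by rewrite intrD; ring.
by rewrite IHp addrCA.
Qed.

Lemma lev_lcollect (T : eqType) (f : T -> A) p : lev f (lcollect p) = lev f p.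
Proof. by elim: p => [|x p IHp] //; rewrite lev_linsert IHp lev_cons. Qed.

(** What remains are the pairs with $k,l\le N<k+l$. *)
Lemma defectE x u y v N : adjacent_words (x :: u) (y :: v) ->
  lev (wsum^~ N) (defect (x :: u) (y :: v)) =
  \sum_(i < N) mon x i.+1 * wsum u i * (wsum (y :: v) N - wsum (y :: v) (N - i.+1)).
Proof.
move=> adj; rewrite lev_cat lev_opp stuffleE // shuffleE //.
under [RHS]eq_bigr do rewrite mulrBr.
by rewrite sumrB -mulr_suml.
Qed.

Lemma reg_defectE x u y v N :
  adjacent_words (x :: u) (y :: v) -> adjacent_words ((0, 1)%N :: u) (y :: v) ->
  lev (wsum^~ N) (reg_defect x u (y :: v)) =
  \sum_(i < N) (mon x i.+1 - (if x == (1, 1)%N then mon (0, 1)%N i.+1 else 0))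
    * wsum u i * (wsum (y :: v) N - wsum (y :: v) (N - i.+1)).
Proof.
rewrite /reg_defect; case: eqP => [->|_] adj adj0; last first.
  by rewrite defectE //; apply: eq_bigr => i _; rewrite subr0.
rewrite lev_cat lev_opp !defectE // -sumrB.
by apply: eq_bigr => i _; rewrite -!mulrA -mulrBl.
Qed.

(** By [lam_adj], $L_1(k)-L_0(k)=L_1(k)L_0(k)$, which is of order $k^{-2}$ like any power with
    exponent at least 2. *)
Lemma reg_head_bound x : (x == (1, 1)%N) || (1 < x.2)%N ->
  exists2 C, 0 <= C & forall k,
    nrm (mon x k.+1 - (if x == (1, 1)%N then mon (0, 1)%N k.+1 else 0))
    <= C / k.+1%:R ^+ 2.
Proof.
case: eqP => [-> _|_ /=].
  have [C C0 hC] := lam_bound 1; have [D D0 hD] := lam_bound 0.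
  exists (C * D); first exact: mulr_ge0.
  move=> k; rewrite /mon /= !expr1 -lam_adj (le_trans (nrmM _ _)) //.
  rewrite expr2 invfM mulrACA; apply: ler_pM => //; exact: nrm_ge0.
case: x => a [//|[//|m]] _; have [C C0 hC] := lam_pow_bound a m.+2.
exists C => // k; rewrite subr0 (le_trans (hC k)) // ler_wpM2l //.
rewrite lef_pV2 ?posrE ?exprn_gt0 // ler_weXn2l //.
by rewrite ler1n.
Qed.

(** Multiplication by the factor [w] is an exact stuffle and costs the fourth power of the gauge. *)
Lemma rel_bound r : rel_valid r -> exists2 D, 0 <= D & forall N,
  nrm (lev (wsum^~ N) (rel_lin r)) <= D * (gauge R N ^+ 4 / N.+1%:R).
Proof.
case: r => c x u v w /and5P[hx hv hu pv /and4P[pw adj adj0 adjw]].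
case: v hv pv adj adj0 adjw => [//|y v] _ pv adj adj0 adjw.
have [C C0 hC] := reg_head_bound hx.
have [D D0 hD] := defect_bound C0 hC hu pv.
have [E E0 hE] := wsum_bound pw.
exists (`|c|%:~R * (D * E)); first by rewrite !mulr_ge0 // ler0z normr_ge0.
move=> N; rewrite lev_scale (le_trans (nrm_int _ _)) //.
rewrite -mulrA ler_wpM2l ?ler0z ?normr_ge0 //.
have -> : lev (wsum^~ N) (lbind (fun t => stuffle t w) (reg_defect x u (y :: v)))
    = lev (wsum^~ N) (reg_defect x u (y :: v)) * wsum w N.
  rewrite lev_bind -lev_mulr; apply: eq_big_seq => t tin.
  by rewrite stuffleE //; apply: (allP adjw).
rewrite reg_defectE // (le_trans (nrmM _ _)) //.
have -> : D * E * (gauge R N ^+ 4 / N.+1%:R)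
  = D * (gauge R N ^+ 3 / N.+1%:R) * (E * gauge R N) by ring.
by apply: ler_pM => //; exact: nrm_ge0.
Qed.

Lemma rels_bound rs : all rel_valid rs -> exists2 D, 0 <= D & forall N,
  nrm (lev (wsum^~ N) (flatten (map rel_lin rs))) <= D * (gauge R N ^+ 4 / N.+1%:R).
Proof.
elim: rs => [|r rs IHrs] /=.
  by exists 0 => // N; rewrite lev_nil nrm0 mul0r.
move=> /andP[/rel_bound [C C0 hC] /IHrs [D D0 hD]].
exists (C + D) => [|N]; first exact: addr_ge0.
by rewrite lev_cat mulrDl (le_trans (nrmD _ _)) ?lerD.
Qed.

End DoubleShuffle.

(** * Multiple zeta values as limits of truncated sums *)

Section TruncatedMzv.

Variable R : realType.

Fixpoint zsum (s : seq nat) (N : nat) : R :=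
  if s is i :: s' then \sum_(k < N) k.+1%:R ^- i * zsum s' k else 1.

Definition mzv_term (s t : seq nat) : R :=
  \prod_(i < size s) (nth 0%N t i)%:R ^- nth 0%N s i.

(** Enumerated by the largest entry, parallel to the recursion of [zsum]. *)
Fixpoint decr_seqs (d N : nat) : seq (seq nat) :=
  if d is d'.+1 then
    flatten [seq [seq k.+1 :: t | t <- decr_seqs d' k] | k <- iota 0 N]
  else [:: [::]].

Lemma mzv_term_ge0 s t : 0 <= mzv_term s t.
Proof. by apply: prodr_ge0 => i _; rewrite invr_ge0 exprn_ge0. Qed.

Lemma sum_decr_seqs s N : \sum_(t <- decr_seqs (size s) N) mzv_term s t = zsum s N.
Proof.
elim: s N => [|i s IHs] N; first by rewrite big_seq1 /mzv_term big_ord0.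
rewrite /= big_flatten big_map -[X in iota _ X]subn0 -/(index_iota 0 N) big_mkord.
apply: eq_bigr => k _; rewrite big_map -IHs mulr_sumr; apply: eq_bigr => t _.
by rewrite /mzv_term big_ord_recl.
Qed.

Lemma gtn_trans : transitive gtn.
Proof. by move=> y x z /= yx zy; exact: ltn_trans zy yx. Qed.

Lemma mem_decr_seqs d N t : (t \in decr_seqs d N) =
  [&& size t == d, sorted gtn t, all (fun x => 0 < x)%N t & all (fun x => x <= N)%N t].
Proof.
elim: d N t => [|d IHd] N t; first by case: t.
apply/flatten_mapP/idP => [[k]|].
  rewrite mem_iota => kN /mapP[t']; rewrite IHd => /and4P[st' srt pt' tk] -> /=.
  rewrite eqSS st' pt' (path_sortedE gtn_trans) srt andbT /= ; apply/and3P; split.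
  - by apply: sub_all tk => x; rewrite /= ltnS.
  - by lia.
  - by apply: sub_all tk => x; lia.
case: t => [|[|k] t] //=; first by rewrite !andbF.
rewrite eqSS (path_sortedE gtn_trans) => /and4P[st /andP[tk srt] pt /andP[kN _]].
exists k; first by rewrite mem_iota add0n.
by rewrite map_f // IHd st srt pt; apply: sub_all tk => x; rewrite /= ltnS.
Qed.

Lemma uniq_decr_seqs d N : uniq (decr_seqs d N).
Proof.
elim: d N => [//|d IHd] N /=; apply: (@allpairs_uniq_dep _ _ _ (fun k t => k.+1 :: t)).
- exact: iota_uniq.
- by move=> k _; exact: IHd.
- by move=> [k t] [k' t'] _ _ /= [-> ->].
Qed.

Definition decr_tuples (d N : nat) : seq (d.-tuple nat) := pmap insub (decr_seqs d N).

Lemma mem_decr_tuples d N (t : d.-tuple nat) :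
  (t \in decr_tuples d N) = (val t \in decr_seqs d N).
Proof. by rewrite mem_pmap_sub. Qed.

Lemma uniq_decr_tuples d N : uniq (decr_tuples d N).
Proof. exact/pmap_sub_uniq/uniq_decr_seqs. Qed.

Lemma sum_decr_tuples s N :
  \sum_(t <- decr_tuples (size s) N) mzv_term s t = zsum s N.
Proof.
rewrite -sum_decr_seqs /decr_tuples.
rewrite -(big_map val xpredT (mzv_term s)) /= pmap_filter; last exact: insubK.
(* [insub] discards nothing, since every listed sequence has the required length. *)
congr bigop; apply/all_filterP/allP => t; rewrite mem_decr_seqs => /and4P[st _ _ _].
by case: insubP => //; rewrite st.
Qed.

Lemma mzvE s : mzv R s = fine (\esum_(k in [set k : (size s).-tuple nat |
    sorted gtn k /\ all (fun x => 0 < x)%N k]) (mzv_term s k)%:E).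
Proof.
rewrite /mzv; congr fine; apply: eq_esum => k _; congr (_%:E).
by apply: eq_bigr => i _; rewrite !(tnth_nth 0%N).
Qed.

Lemma zsum_mono s : {homo zsum s : m n / (m <= n)%N >-> m <= n}.
Proof.
have zsum_ge0 t N : 0 <= zsum t N.
  elim: t N => [|i t IHt] N; first exact: ler01.
  by apply: sumr_ge0 => k _; rewrite mulr_ge0 // invr_ge0 exprn_ge0.
case: s => [m n _|i s]; first exact: lexx.
apply: homo_leq => [x|y x z|N]; [exact: lexx|exact: le_trans|].
by rewrite /= big_ord_recr lerDl mulr_ge0 // invr_ge0 exprn_ge0.
Qed.

(** The unordered sum is a supremum over finite sets of tuples; each such set lies in some
    [decr_tuples], and these are themselves finite sets of tuples. *)
Lemma mzv_lub s B : (forall N, zsum s N <= B) ->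
  mzv R s <= B /\ forall N, zsum s N <= mzv R s.
Proof.
move=> hB; rewrite mzvE.
set J := [set k | _]; set e := esum _ _.
have eB : (e <= B%:E)%E.
  apply: ub_ereal_sup => _ [X [finX XJ] <-].
  have [r [ur Xr]] : exists r : seq ((size s).-tuple nat), uniq r /\ X = [set` r].
    have /finite_seqP[r Xr] := finX; exists (undup r); split; first exact: undup_uniq.
    by rewrite Xr; apply/seteqP; split=> x /=; rewrite mem_undup.
  rewrite Xr -fsbig_seq // sumEFin lee_fin.
  (* The largest entry of all tuples in the finite set. *)
  pose N := \max_(t <- r) \max_(x <- val t) x.
  apply: le_trans (hB N); rewrite -sum_decr_tuples.
  rewrite [leRHS](bigID (mem r)) /= -[X in _ <= X + _]big_filter.
  rewrite [leLHS](perm_big [seq t <- decr_tuples (size s) N | t \in r]) /=.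
    by rewrite lerDl sumr_ge0 // => t _; exact: mzv_term_ge0.
  apply: uniq_perm => //; first exact/filter_uniq/uniq_decr_tuples.
  move=> t; rewrite mem_filter; case tr: (t \in r) => //=; apply/esym.
  rewrite mem_decr_tuples mem_decr_seqs size_tuple eqxx /=.
  have [-> -> /=] : J t by apply: XJ; rewrite Xr.
  apply/allP => x xt; rewrite /N; apply: leq_trans (leq_bigmax_seq _ tr isT).
  exact: leq_bigmax_seq.
have eN N : ((zsum s N)%:E <= e)%E.
  apply: esum_ge; exists [set` decr_tuples (size s) N].
    split; first exact: finite_seq.
    move=> t /=; rewrite mem_decr_tuples mem_decr_seqs => /and4P[_ ? ? _].
    by split.
  by rewrite -fsbig_seq ?uniq_decr_tuples // sumEFin sum_decr_tuples.
(* Finiteness ensures that [fine] does not return its default value 0. *)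
have efin : e \is a fin_num.
  rewrite fin_numElt (le_lt_trans eB) ?ltry // andbT.
  by rewrite (lt_le_trans _ (eN 0%N)) // ltNyr.
by split => [|N]; rewrite -lee_fin fineK.
Qed.

Lemma zsum_cvg s B : (forall N, zsum s N <= B) -> zsum s @ \oo --> mzv R s.
Proof.
move=> hB; have [_ hle] := mzv_lub hB.
have ubB : has_ubound (range (zsum s)) by exists B => _ [N _ <-].
have -> : mzv R s = sup (range (zsum s)).
  apply/eqP; rewrite eq_le; apply/andP; split.
    have [] // := @mzv_lub s (sup (range (zsum s))) => N.
    by apply: ub_le_sup => //; exists N.
  by apply: ge_sup => [|_ [N _ <-]]; [exists (zsum s 0), 0%N|exact: hle].
by apply: nondecreasing_cvgn => // m n; exact: zsum_mono.
Qed.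

(** The inner sums are bounded by the gauge, and a leading exponent at least 2 makes the outer sum
    converge by [sum_gauge_sqr]. *)
Lemma zsum_bound s i : (1 < i)%N -> all (fun x => 0 < x)%N s ->
  exists B, forall N, zsum (i :: s) N <= B.
Proof.
move=> i1 ps.
have inv_le k j : (0 < j)%N -> k.+1%:R ^- j <= k.+1%:R^-1 :> R.
  move=> j0; rewrite lef_pV2 ?posrE ?exprn_gt0 //.
  by rewrite ler_eXnr // ler1n.
have zsum_ge0 t N : 0 <= zsum t N.
  by apply: le_trans (zsum_mono t (leq0n N)); case: t => [|? ?] /=; rewrite ?big_ord0.
have [C C0 hC] : exists2 C, 0 <= C & forall N, zsum s N <= C * gauge R N.
  elim: s ps {i i1} => [_|j s IHs /= /andP[j0 ps]].
    by exists 1 => // N; rewrite mul1r gauge_ge1.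
  have [C C0 hC] := IHs ps; exists (C * 16); first exact: mulr_ge0.
  move=> N; apply: (@le_trans _ _ (\sum_(k < N) C * (gauge R k / k.+1%:R))).
    apply: ler_sum => k _; rewrite mulrA mulrC ler_pM ?invr_ge0 ?exprn_ge0 //.
    exact: inv_le.
  rewrite -mulr_sumr sum_gauge mulrA ler_wpM2l ?mulr_ge0 //.
  by rewrite lerBlDr lerDl ler01.
exists (C * 3) => N.
apply: (@le_trans _ _ (\sum_(k < N) C * (gauge R k / k.+1%:R ^+ 2))).
  apply: ler_sum => k _; rewrite mulrA mulrC ler_pM ?invr_ge0 ?exprn_ge0 //.
  rewrite lef_pV2 ?posrE ?exprn_gt0 // ler_weXn2l //.
  by rewrite ler1n.
rewrite -mulr_sumr ler_wpM2l // (le_trans (sum_gauge_sqr _ _)) //.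
by rewrite lerBlDr lerDl divr_ge0 ?mulr_ge0 ?gauge_ge0.
Qed.

End TruncatedMzv.

(** * Coefficients of truncated sums *)

(* [lcoef a m i] is the coefficient of [(x/k)^i] in [(x/(k - a x))^m]. *)
Fixpoint lcoef (a m i : nat) : nat :=
  if m is m'.+1 then \sum_(j < i) a ^ j * lcoef a m' (i - j.+1) else (i == 0%N).

(** The coefficient of $x^n$ in the sum of a word, with an arbitrary [F] in place of zeta, so that
    truncated sums and their limits share one expression. *)
Fixpoint wcoef (R : pzSemiRingType) (w : word) (n : nat) (F : seq nat -> R) : R :=
  if w is x :: w' then
    \sum_(i < n.+1) (lcoef x.1 x.2 i)%:R * wcoef w' (n - i) (fun s => F ((i : nat) :: s))
  else (n == 0%N)%:R * F [::].

(** * Power series modulo $x^{n+1}$ as an instance of the abstract ring *)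

Section TruncatedSeries.

Variables (R : realType) (n : nat).

Local Notation T := {poly %/ ('X^(n.+1) : {poly R})}.

(** The truncated expansion of $1/(k-ax)$. *)
Definition geom (a k : nat) : {poly R} := \poly_(i < n.+1) (a%:R ^+ i / k%:R ^+ i.+1).
Definition slam (a k : nat) : T := in_qpoly _ ('X * geom a k).
Definition snrm (f : T) : R := \sum_(i < n.+1) `|(f : {poly R})`_i|.

Lemma coef_in_qpoly (p : {poly R}) i : (i <= n)%N ->
  (in_qpoly 'X^(n.+1) p : {poly R})`_i = p`_i.
Proof.
by move=> ni; rewrite /= mk_monic_Xn -Pdiv.RingMonic.take_poly_rmodp coef_take_poly ltnS ni.
Qed.

Lemma coef_smul (f g : T) i : (i <= n)%N ->
  (f * g : T)`_i = \sum_(j < i.+1) f`_j * g`_(i - j).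
Proof. by move=> ni; rewrite [LHS](coef_in_qpoly _ ni) coefM. Qed.

Lemma coef_s1 i : (1 : T)`_i = (i == 0%N)%:R.
Proof. exact: coef1. Qed.

Lemma in_qpolyB (p q : {poly R}) :
  in_qpoly 'X^(n.+1) (p - q) = in_qpoly _ p - in_qpoly _ q.
Proof. by rewrite -scaleN1r in_qpolyD in_qpolyZ scaleN1r. Qed.

Lemma geom_inv a k : in_qpoly 'X^(n.+1) (k.+1%:R%:P - a%:R *: 'X) * in_qpoly _ (geom a k.+1) = 1.
Proof.
rewrite -in_qpolyM -[RHS]in_qpoly1.
have k0 : k.+1%:R != 0 :> R by rewrite pnatr_eq0.
have -> : (k.+1%:R%:P - a%:R *: 'X) * geom a k.+1 =
    1 - (a%:R ^+ n.+1 / k.+1%:R ^+ n.+1) *: 'X^(n.+1) :> {poly R}.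
  apply/polyP => i; rewrite mulrBl -scalerAl !coefB coefCM !coefZ coefXM !coef_poly.
  rewrite coef1 coefXn; case: i => [|i] /=.
    by rewrite expr0 expr1 !mulr0 !subr0 mulrCA divff // mulr1.
  rewrite !ltnS eqSS sub0r; case: (ltngtP i n) => [i1|i1|->] /=.
  - rewrite mulr0 oppr0; apply/eqP; rewrite subr_eq0; apply/eqP.
    rewrite !exprS; move: (k.+1%:R : R) k0 => c c0; field.
    by rewrite c0 expf_neq0.
  - by rewrite !mulr0 subr0 oppr0.
  - by rewrite mulr0 sub0r mulr1 mulrA -exprS.
rewrite in_qpolyB in_qpolyZ.
suff -> : in_qpoly 'X^(n.+1) ('X^(n.+1) : {poly R}) = 0 by rewrite scaler0 subr0.
by apply/val_eqP; rewrite /= mk_monic_Xn Pdiv.RingMonic.rmodpp ?monicXn.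
Qed.

Let sX : T := in_qpoly _ 'X.
Let den a k : T := in_qpoly _ (k.+1%:R%:P - a%:R *: 'X).
Let sgeom a k : T := in_qpoly _ (geom a k.+1).

Lemma slamE a k : slam a k.+1 = sX * sgeom a k.
Proof. exact: in_qpolyM. Qed.

(** The denominators $k+1-ax$ and $k+1-(a+1)x$ differ by $x$. *)
Lemma slam_adj a k : slam a.+1 k.+1 * slam a k.+1 = slam a.+1 k.+1 - slam a k.+1.
Proof.
rewrite !slamE.
have e1 : den a.+1 k * sgeom a.+1 k = 1 := geom_inv a.+1 k.
have e0 : den a k * sgeom a k = 1 := geom_inv a k.
have dd : den a k - den a.+1 k = sX.
  rewrite /den /sX -in_qpolyB; congr (in_qpoly _ _).
  by rewrite [a.+1%:R]mulrSr scalerDl scale1r; ring.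
transitivity (sX * sgeom a.+1 k * (den a k * sgeom a k)
              - sX * sgeom a k * (den a.+1 k * sgeom a.+1 k)).
  transitivity (sX * sgeom a.+1 k * sgeom a k * (den a k - den a.+1 k)).
    by rewrite dd; ring.
  by ring.
by rewrite e0 e1 !mulr1.
Qed.

(** The denominators of the two factors add up to that of $L_{a+b}$ at the sum of the indices. *)
Lemma slam_mul a b k l : slam a k.+1 * slam b l.+1 =
  slam (a + b) (k.+1 + l.+1)%N * (slam a k.+1 + slam b l.+1).
Proof.
rewrite addSn !slamE.
have ea : den a k * sgeom a k = 1 := geom_inv a k.
have eb : den b l * sgeom b l = 1 := geom_inv b l.
have eab : den (a + b) (k + l.+1) * sgeom (a + b) (k + l.+1) = 1 := geom_inv _ _.
have dd : den (a + b) (k + l.+1) = den a k + den b l.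
  rewrite /den -in_qpolyD; congr (in_qpoly _ _).
  by rewrite -addSn !natrD scalerDl polyCD; ring.
transitivity (sX * sgeom (a + b) (k + l.+1) *
    (sX * sgeom a k * (den b l * sgeom b l) + sX * sgeom b l * (den a k * sgeom a k))).
  transitivity (sX * sX * sgeom a k * sgeom b l
      * ((den a k + den b l) * sgeom (a + b) (k + l.+1))).
    by rewrite -dd eab; ring.
  ring.
by rewrite ea eb !mulr1.
Qed.

Lemma snrm0 : snrm 0 = 0.
Proof. by rewrite /snrm big1 // => i _; rewrite coef0 normr0. Qed.

Lemma snrm1 : snrm 1 = 1.
Proof.
rewrite /snrm big_ord_recl coef_s1 normr1 big1 ?addr0 // => i _.
by rewrite coef_s1 lift0 normr0.
Qed.

Lemma snrmN f : snrm (- f) = snrm f.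
Proof. by apply: eq_bigr => i _; rewrite coefN normrN. Qed.

Lemma snrmD f g : snrm (f + g) <= snrm f + snrm g.
Proof. by rewrite -big_split; apply: ler_sum => i _; rewrite coefD ler_normD. Qed.

(** The norm is the value at 1 of the polynomial of absolute values; reduction modulo $x^{n+1}$ only
    drops nonnegative terms there. *)
Lemma snrmM f g : snrm (f * g) <= snrm f * snrm g.
Proof.
pose abs (h : T) : {poly R} := \poly_(i < n.+1) `|h`_i|.
have snrmE h : snrm h = (abs h).[1].
  rewrite horner_poly; apply: eq_bigr => i _.
  by rewrite expr1n mulr1.
have abs_ge0 h i : 0 <= (abs h)`_i by rewrite coef_poly; case: ifP.
rewrite !snrmE -hornerM [X in _ <= X](@horner_coef_wide _ (n.+1 + n.+1)); last first.
  rewrite (leq_trans (size_polyMleq _ _)) // (leq_trans (leq_pred _)) //.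
  by rewrite leq_add // size_poly.
rewrite horner_poly big_split_ord /= -[X in X <= _]addr0 lerD //; last first.
  apply: sumr_ge0 => i _; rewrite expr1n mulr1 coefM sumr_ge0 // => j _.
  exact: mulr_ge0.
apply: ler_sum => i _; rewrite !expr1n !mulr1 /=.
have ni : (i <= n)%N by rewrite -ltnS.
rewrite (coef_smul f g ni) coefM.
rewrite (le_trans (ler_norm_sum _ _ _)) //; apply: ler_sum => j _.
have jn : (j < n.+1)%N := leq_trans (ltn_ord j) (ltn_ord i).
by rewrite normrM !coef_poly jn (leq_ltn_trans (leq_subr _ _) (ltn_ord i)).
Qed.

Lemma coef_slam a k i : (i <= n)%N ->
  (slam a k)`_i = if i is j.+1 then a%:R ^+ j / k%:R ^+ i else 0.
Proof.
move=> ni; rewrite coef_in_qpoly // coefXM coef_poly.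
by case: i ni => //= i ni; rewrite ltnS ltnW.
Qed.

Lemma slam_bound a : exists2 C, 0 <= C & forall k, snrm (slam a k.+1) <= C / k.+1%:R.
Proof.
exists (\sum_(i < n.+1) a%:R ^+ i.-1); first by apply: sumr_ge0 => i _; exact: exprn_ge0.
move=> k; rewrite mulr_suml; apply: ler_sum => i _.
have ni : (i <= n)%N by rewrite -ltnS.
rewrite coef_slam //; case: (i : nat) => [|j].
  by rewrite normr0 mulr_ge0 ?exprn_ge0 ?invr_ge0.
rewrite ger0_norm ?mulr_ge0 ?invr_ge0 ?exprn_ge0 // ler_wpM2l ?exprn_ge0 //.
by rewrite lef_pV2 ?posrE ?exprn_gt0 // ler_eXnr // ler1n.
Qed.

Lemma coef_mon x k i : (i <= n)%N ->
  (mon slam x k.+1)`_i = (lcoef x.1 x.2 i)%:R / k.+1%:R ^+ i.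
Proof.
case: x => a m; rewrite /mon /=; elim: m i => [|m IHm] i ni.
  by rewrite [LHS]coef_s1 /=; case: i {ni} => [|i]; rewrite ?mul0r // expr0 divr1.
have -> : slam a k.+1 ^+ m.+1 = slam a k.+1 * slam a k.+1 ^+ m by exact: exprS.
rewrite coef_smul // big_ord_recl coef_slam // mul0r add0r natr_sum mulr_suml.
apply: eq_bigr => j _; rewrite lift0 coef_slam ?IHm; last 2 first.
- exact: leq_trans (leq_subr _ _) ni.
- exact: leq_trans (ltn_ord j) ni.
rewrite mulrACA -invfM -exprD subnKC //.
by rewrite natrM natrX.
Qed.

Lemma wcoef_sum w m N (c : nat -> R) (F : nat -> seq nat -> R) :
  \sum_(k < N) c k * wcoef w m (F k) = wcoef w m (fun s => \sum_(k < N) c k * F k s).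
Proof.
elim: w m F => [|x w IHw] m F /=.
  by rewrite mulr_sumr; apply: eq_bigr => k _; rewrite mulrCA.
under eq_bigr do rewrite mulr_sumr.
rewrite exchange_big; apply: eq_bigr => i _ /=.
rewrite -(IHw _ (fun k s => F k ((i : nat) :: s))) mulr_sumr.
by apply: eq_bigr => k _; rewrite mulrCA.
Qed.

Lemma coef_wsum w N i : (i <= n)%N ->
  (wsum slam w N)`_i = wcoef w i (fun s => zsum R s N).
Proof.
elim: w N i => [|x w IHw] N i ni /=; first by rewrite coef_s1 mulr1.
rewrite coefn_sum.
transitivity (\sum_(k < N) \sum_(j < i.+1) (lcoef x.1 x.2 j)%:R *
    (k.+1%:R ^- j * wcoef w (i - j) (fun s => zsum R s k))).
  apply: eq_bigr => k _; rewrite coef_smul //; apply: eq_bigr => j _.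
  have ji : (j <= i)%N by rewrite -ltnS.
  rewrite coef_mon ?IHw; last 2 first.
  - exact: leq_trans (leq_subr _ _) ni.
  - exact: leq_trans ji ni.
  by rewrite mulrA.
rewrite exchange_big; apply: eq_bigr => j _ /=.
by rewrite -mulr_sumr (wcoef_sum _ _ _ (fun k => k.+1%:R ^- j) (fun k s => zsum R s k)).
Qed.

End TruncatedSeries.

Lemma lcoef0 m i : lcoef 0 m i = (i == m).
Proof.
elim: m i => [//|m IHm] [|i] /=; first by rewrite big_ord0.
rewrite big_ord_recl /= expn0 mul1n subSS subn0 IHm big1 ?addn0 ?eqSS // => j _.
by rewrite exp0n.
Qed.

Lemma wcoef_shift0 (R : pzSemiRingType) w n (F : seq nat -> R) :
  all (fun x => x.1 == 0%N) w -> (sumn (map snd w) < n)%N -> wcoef w n F = 0.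
Proof.
elim: w n F => [|[a m] w IHw] n F /=; first by case: n => [|n] //; rewrite mul0r.
move=> /andP[/eqP-> w0] wn; rewrite big1 // => i _; rewrite lcoef0.
case: eqP => [im|_]; last by rewrite mul0r.
by rewrite IHw ?mulr0 // im ltn_subRL.
Qed.

Lemma lcoef_n0 a m : (0 < m)%N -> lcoef a m 0 = 0%N.
Proof. by case: m => [//|m] _; rewrite /= big_ord0. Qed.

Lemma lcoef1 a i : lcoef a 1 i.+1 = (a ^ i)%N.
Proof.
rewrite /= big_ord_recr /= subnn muln1 big1 ?add0n // => j _.
by rewrite subSS subn_eq0 leqNgt ltn_ord muln0.
Qed.

Lemma lcoef12 i : lcoef 1 2 i.+1 = i.
Proof.
rewrite [LHS]/= -/(lcoef 1 1) big_ord_recr /= subnn big_ord0 muln0 addn0.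
rewrite (eq_bigr (fun=> 1%N)) ?sum1_card ?card_ord // => j _.
rewrite exp1n mul1n subSS; case E : (i - j)%N => [|k].
  by move/eqP: E; rewrite subn_eq0 leqNgt ltn_ord.
by rewrite -/(lcoef 1 1 k.+1) lcoef1 exp1n.
Qed.

(** * Coefficients as sums over boxes of exponents *)

Section ExponentSums.

Variable R : comPzRingType.

(** The shape of the sums in the theorem: fixed ranges and one final constraint, with [acc] the
    total of the exponents already chosen. *)
Fixpoint wrect (B : nat) (w : word) (acc n : nat) (F : seq nat -> R) : R :=
  if w is x :: w' then
    \sum_(1 <= i < B) (lcoef x.1 x.2 i)%:R * wrect B w' (acc + i) n (fun s => F (i :: s))
  else (acc == n)%:R * F [::].

Lemma wrect_cons B x w acc n F : wrect B (x :: w) acc n F =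
  \sum_(1 <= i < B) (lcoef x.1 x.2 i)%:R * wrect B w (acc + i) n (fun s => F (i :: s)).
Proof. by []. Qed.

Lemma wcoef_small w m (F : seq nat -> R) : positive_word w -> (m < size w)%N ->
  wcoef w m F = 0.
Proof.
elim: w m F => [//|x w IHw] m F /= /andP[x0 pw] mw; rewrite big1 // => i _.
case: (posnP i) => [->|i0]; first by rewrite lcoef_n0 // mul0r.
by rewrite IHw ?mulr0 //; have := ltn_ord i; lia.
Qed.

Lemma wrect_large B w acc n F : (n < acc)%N -> wrect B w acc n F = 0.
Proof.
elim: w acc F => [|x w IHw] acc F an /=; first by rewrite gtn_eqF // mul0r.
rewrite big_nat big1 // => i _; rewrite IHw ?mulr0 //.
exact: leq_trans an (leq_addr _ _).
Qed.

(** In a positive word the other exponents are at least 1, so none exceeds $m-(d-1)$ for $d$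
    letters; hence the box bound [B] cuts off nothing. *)
Lemma wcoef_rect B w acc m F : positive_word w -> (m < B + (size w).-1)%N || (w == [::]) ->
  wcoef w m F = wrect B w acc (acc + m) F.
Proof.
elim: w acc m F => [|x w IHw] acc m F /=.
  by move=> _ _; have -> : (acc == acc + m)%N = (m == 0)%N by lia.
move=> /andP[x0 pw]; rewrite orbF => mB.
rewrite -(big_mkord xpredT (fun i => (lcoef x.1 x.2 i)%:R
  * wcoef w (m - i) (fun s => F (i :: s)))).
rewrite big_ltn // lcoef_n0 // mul0r add0r.
have IH i : (0 < i <= m)%N -> wcoef w (m - i) (fun s => F (i :: s))
    = wrect B w (acc + i) (acc + m) (fun s => F (i :: s)).
  move=> /andP[i0 im]; rewrite (IHw (acc + i)%N) //.
    by rewrite -addnA subnKC.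
  by case: (w) mB => [|z w'] /= mB; lia.
case: (leqP B m.+1) => Bm.
  case: (posnP B) mB => [->|B0] mB.
    rewrite [RHS]big_geq // big_nat big1 // => i /andP[i0 im].
    by rewrite wcoef_small ?mulr0 //; lia.
  rewrite (big_cat_nat (n := B)) //= [X in _ + X]big_nat [X in _ + X]big1 ?addr0.
    by apply: eq_big_nat => i iB; rewrite IH //; lia.
  by move=> i iB; rewrite wcoef_small ?mulr0 //; lia.
rewrite [RHS](big_cat_nat (n := m.+1)) //=; last exact: ltnW.
rewrite [X in _ + X]big_nat [X in _ + X]big1 ?addr0.
  by apply: eq_big_nat => i iB; rewrite IH.
by move=> i iB; rewrite wrect_large ?mulr0 //; lia.
Qed.

Lemma wcoef_shift0_cons m w n (F : seq nat -> R) : (m <= n)%N ->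
  wcoef ((0, m)%N :: w) n F = wcoef w (n - m) (fun s => F (m :: s)).
Proof.
move=> mn; have mn' : (m < n.+1)%N by rewrite ltnS.
rewrite /= (bigD1 (Ordinal mn')) //= lcoef0 eqxx mul1r big1 ?addr0 // => i im.
rewrite lcoef0; case: eqP => [im'|]; last by rewrite mul0r.
by case/eqP: im; apply/val_inj.
Qed.

Lemma wcoef1 x n (F : seq nat -> R) :
  wcoef [:: x] n F = (lcoef x.1 x.2 n)%:R * F [:: n].
Proof.
rewrite /= big_ord_recr /= subnn eqxx mul1r big1 ?add0r // => i _.
by rewrite subn_eq0 leqNgt ltn_ord mul0r mulr0.
Qed.

Lemma wcoef2_shift0 x m n (F : seq nat -> R) : (m <= n)%N ->
  wcoef [:: x; (0, m)%N] n F = (lcoef x.1 x.2 (n - m))%:R * F [:: (n - m)%N; m].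
Proof.
move=> mn; have nm : (n - m < n.+1)%N by rewrite ltnS leq_subr.
transitivity (\sum_(i < n.+1) (lcoef x.1 x.2 i)%:R
    * ((n - i == m)%N%:R * F [:: (i : nat); (n - i)%N])).
  apply: eq_bigr => i _; congr (_ * _); rewrite -lcoef0.
  exact: (wcoef1 (0, m)%N (n - i) (fun s => F ((i : nat) :: s))).
rewrite (bigD1 (Ordinal nm)) //= subKn // eqxx mul1r big1 ?addr0 // => i im.
case: eqP => [im'|]; last by rewrite mul0r mulr0.
by case/eqP: im; apply/val_inj => /=; have := ltn_ord i; lia.
Qed.

(* Subtracting the leading letter (0, 1) removes exactly the leading exponent 1. *)
Lemma wcoef_head_diff a w n (F : seq nat -> R) :
  (1 < n)%N -> w != [::] -> positive_word w ->
  wcoef ((a, 1)%N :: w) n F - wcoef ((0, 1)%N :: w) n F =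
  \sum_(2 <= i < n) a%:R ^+ (i - 1) * wrect n w i n (fun s => F (i :: s)).
Proof.
move=> n1 w0 pw; have pw' b : positive_word ((b, 1)%N :: w) by [].
have nw : (n < n + (size w))%N by case: w w0 {pw pw'} => [|z w'] //= _; lia.
rewrite !(wcoef_rect (B := n) 0) ?[(size _).-1]/= ?nw //.
rewrite !wrect_cons -sumrB big_ltn // -mulrBl !lcoef1 subrr mul0r add0r.
apply: eq_big_nat => -[//|[//|i]] _; rewrite -mulrBl !lcoef1 exp0n // subr0 natrX.
by rewrite subSS subn0.
Qed.

End ExponentSums.

Section WrectEval.

Variables (R : comPzRingType) (B acc n : nat).

Lemma wrect1 a (F : seq nat -> R) : wrect B [:: (a, 1)%N] acc n F =
  \sum_(1 <= i < B | (acc + i == n)%N) a%:R ^+ (i - 1) * F [:: i].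
Proof.
rewrite [RHS]big_mkcond; apply: eq_big_nat => -[//|i] _.
rewrite lcoef1 natrX subSS subn0 /=.
by case: eqP => _; rewrite ?mul1r // mul0r mulr0.
Qed.

Lemma wrect_simple_pole a w (F : seq nat -> R) : wrect B ((a, 1)%N :: w) acc n F =
  \sum_(1 <= i < B) a%:R ^+ (i - 1) * wrect B w (acc + i) n (fun s => F (i :: s)).
Proof. by apply: eq_big_nat => -[//|i] _; rewrite lcoef1 natrX subSS subn0. Qed.

Lemma wrect_shift0 w (F : seq nat -> R) : (1 < B)%N ->
  wrect B (L01 :: w) acc n F = wrect B w (acc + 1) n (fun s => F (1%N :: s)).
Proof.
move=> B1; rewrite wrect_simple_pole big_ltn // expr0 mul1r big_nat big1 ?addr0 //.
by move=> [//|[//|i]] _; rewrite expr0n mul0r.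
Qed.

End WrectEval.

(* The difference of the two sides of the theorem, with zeta replaced by [F]. *)
Definition identity_gap (R : realType) (n : nat) (F : seq nat -> R) : R :=
  (2 * (\sum_(2 <= i < n) \sum_(1 <= j < n)
         \sum_(1 <= l < n | (i + j + l == n - 1)%N)
           F [:: i; 1; j; l]%N)
  - (\sum_(2 <= i < n) \sum_(1 <= j < n) \sum_(1 <= k < n)
       \sum_(1 <= l < n | (i + j + k + l == n)%N)
         (2 ^+ (i - 1) + 2 ^+ k) * F [:: i; j; k; l])
  - (\sum_(2 <= k < n) \sum_(1 <= j < n | (k + j == n - 1)%N)
       k%:R * F [:: k; 1; j]%N))
  - (2 * F [:: 2; n - 2]%N
    + (n%:R - 3) * F [:: n - 2; 2]%N
    - (2 * n%:R - 5) * F [:: n - 1; 1]%N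
    - (n%:R + 5) / 2 * F [:: n]).

(** Each word, or difference of words with leading exponent 1 removed, is matched with one sum; the
    factor 2 clears the denominator of $(n+5)/2$. *)
Lemma target_lin_gap (R : realType) n (F : seq nat -> R) : (5 <= n)%N ->
  lev (fun w => wcoef w n F) target_lin = 2 * identity_gap n F.
Proof.
move=> n5; have n1 : (1 < n)%N by lia.
set S1 := \sum_(2 <= i < n) \sum_(1 <= j < n) \sum_(1 <= k < n | (i + 1 + j + k == n)%N)
  F [:: i; 1; j; k]%N.
set S2 := \sum_(2 <= i < n) \sum_(1 <= j < n) \sum_(1 <= k < n)
  \sum_(1 <= m < n | (i + j + k + m == n)%N) 2 ^+ (i - 1) * F [:: i; j; k; m].
set S3 := \sum_(2 <= i < n) \sum_(1 <= j < n) \sum_(1 <= k < n)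
  \sum_(1 <= m < n | (i + j + k + m == n)%N) 2 ^+ (k - 1) * F [:: i; j; k; m].
set S4 := \sum_(2 <= i < n) \sum_(1 <= j < n | (i + 1 + j == n)%N) F [:: i; 1; j]%N.
set S5 := \sum_(2 <= i < n) \sum_(1 <= j < n | (i + 1 + j == n)%N)
  (i - 1)%:R * F [:: i; 1; j]%N.
have e1 : wcoef [:: L11; L01; L11; L11] n F - wcoef [:: L01; L01; L11; L11] n F = S1.
  rewrite wcoef_head_diff //; apply: eq_big_nat => i _.
  rewrite expr1n mul1r wrect_shift0 // wrect_simple_pole; apply: eq_big_nat => j _.
  rewrite expr1n mul1r wrect1; apply: eq_bigr => k _.
  by rewrite expr1n mul1r.
have e2 : wcoef [:: L21; L11; L11; L11] n F - wcoef [:: L01; L11; L11; L11] n F = S2.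
  rewrite wcoef_head_diff //; apply: eq_big_nat => i _.
  rewrite wrect_simple_pole mulr_sumr; apply: eq_big_nat => j _.
  rewrite expr1n mul1r wrect_simple_pole mulr_sumr; apply: eq_big_nat => k _.
  rewrite expr1n mul1r wrect1 mulr_sumr; apply: eq_bigr => m _.
  by rewrite expr1n mul1r.
have e3 : wcoef [:: L11; L11; L21; L11] n F - wcoef [:: L01; L11; L21; L11] n F = S3.
  rewrite wcoef_head_diff //; apply: eq_big_nat => i _.
  rewrite expr1n mul1r wrect_simple_pole; apply: eq_big_nat => j _.
  rewrite expr1n mul1r wrect_simple_pole; apply: eq_big_nat => k _.
  rewrite wrect1 mulr_sumr; apply: eq_bigr => m _.
  by rewrite expr1n mul1r.
have e4 : wcoef [:: L11; L01; L11] n F - wcoef [:: L01; L01; L11] n F = S4.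
  rewrite wcoef_head_diff //; apply: eq_big_nat => i _.
  rewrite expr1n mul1r wrect_shift0 // wrect1; apply: eq_bigr => k _.
  by rewrite expr1n mul1r.
have e5 : wcoef [:: L12; L01; L11] n F = S5.
  rewrite (wcoef_rect (B := n) 0) //; last by rewrite /= orbF; lia.
  (* The leading exponent 1 drops out by itself, since its coefficient in $(x/(k-x))^2$ is 0. *)
  rewrite wrect_cons big_ltn // lcoef12 mul0r add0r; apply: eq_big_nat => -[//|i] _.
  rewrite lcoef12 wrect_shift0 // wrect1 mulr_sumr; apply: eq_bigr => k _.
  by rewrite expr1n mul1r subSS subn0.
have e6 : wcoef [:: L02; L11] n F = F [:: 2; n - 2]%N.
  rewrite wcoef_shift0_cons ?wcoef1; last lia.
  case E : (n - 2)%N => [|m]; first lia.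
  by rewrite lcoef1 exp1n mul1r.
have e7 : wcoef [:: L12; L02] n F = (n%:R - 3) * F [:: n - 2; 2]%N.
  rewrite wcoef2_shift0; last lia.
  have -> : (n - 2 = (n - 3).+1)%N by lia.
  by rewrite lcoef12 natrB //; lia.
have e8 : wcoef [:: L12; L01] n F = (n%:R - 2) * F [:: n - 1; 1]%N.
  rewrite wcoef2_shift0; last lia.
  have -> : (n - 1 = (n - 2).+1)%N by lia.
  by rewrite lcoef12 natrB //; lia.
have e9 : wcoef [:: L11; L01] n F = F [:: n - 1; 1]%N.
  rewrite wcoef2_shift0; last lia.
  have -> : (n - 1 = (n - 2).+1)%N by lia.
  by rewrite lcoef1 exp1n mul1r.
have e10 : wcoef [:: L12] n F = (n%:R - 1) * F [:: n].
  rewrite wcoef1; have -> : n = (n - 1).+1 by lia.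
  by rewrite lcoef12 mulrSr addrK.
have e11 : wcoef [:: L11] n F = F [:: n].
  rewrite wcoef1; have -> : n = (n - 1).+1 by lia.
  by rewrite lcoef1 exp1n mul1r.
have h1 : \sum_(2 <= i < n) \sum_(1 <= j < n)
    \sum_(1 <= l < n | (i + j + l == n - 1)%N) F [:: i; 1; j; l]%N = S1.
  apply: eq_bigr => i _; apply: eq_bigr => j _; apply: eq_bigl => k.
  by apply/eqP/eqP; lia.
have h2 : \sum_(2 <= i < n) \sum_(1 <= j < n) \sum_(1 <= k < n)
    \sum_(1 <= l < n | (i + j + k + l == n)%N)
      (2 ^+ (i - 1) + 2 ^+ k) * F [:: i; j; k; l] = S2 + 2 * S3.
  (* The weight is split as $2^{i-1}+2\cdot 2^{k-1}$, one summand for each position of the letter of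
     shift 2. *)
  rewrite mulr_sumr -big_split; apply: eq_bigr => i _ /=.
  rewrite mulr_sumr -big_split; apply: eq_bigr => j _ /=.
  rewrite mulr_sumr -big_split; apply: eq_big_nat => -[//|k] _ /=.
  rewrite mulr_sumr -big_split; apply: eq_bigr => m _ /=.
  by rewrite mulrDl subSS subn0 exprS mulrA.
have h3 : \sum_(2 <= k < n) \sum_(1 <= j < n | (k + j == n - 1)%N)
    k%:R * F [:: k; 1; j]%N = S4 + S5.
  (* The weight $k$ is split as $1+(k-1)$, for the leading letters [L11] and [L12]. *)
  rewrite -big_split; apply: eq_big_nat => -[//|i] _ /=; rewrite -big_split /=.
  apply: eq_big => [k|k _]; first by apply/eqP/eqP; lia.
  by rewrite subSS subn0 mulrSr; ring.
rewrite /identity_gap h1 h2 h3.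
clearbody S1 S2 S3 S4 S5.
have levE (W : word -> R) : lev W target_lin =
    4 * (W [:: L11; L01; L11; L11] - W [:: L01; L01; L11; L11])
    - 2 * (W [:: L21; L11; L11; L11] - W [:: L01; L11; L11; L11])
    - 4 * (W [:: L11; L11; L21; L11] - W [:: L01; L11; L21; L11]) - 2 * W [:: L12; L01; L11]
    - 2 * (W [:: L11; L01; L11] - W [:: L01; L01; L11]) - 4 * W [:: L02; L11] - 2 * W [:: L12; L02]
    + 4 * W [:: L12; L01] - 2 * W [:: L11; L01] + W [:: L12] + 6 * W [:: L11].
  by rewrite /lev !big_cons big_nil /=; ring.
(* The coefficients of $\zeta(n-1,1)$ and $\zeta(n)$ come out as $4(n-2)-2=2(2n-5)$ and
   $(n-1)+6=n+5$. *)
by rewrite levE e1 e2 e3 e4 e5 e6 e7 e8 e9 e10 e11; field.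
Qed.

(** Up to negligible words, twice the gap is the coefficient of $x^n$ in the certificate, and a
    single coefficient is at most the norm. *)
Lemma certificate_bound (R : realType) n : (5 <= n)%N -> exists2 D, 0 <= D & forall N,
  `|identity_gap n (fun s => zsum R s N)| <= D * (gauge R N ^+ 4 / N.+1%:R).
Proof.
move=> n5; pose lam := @slam R n.
have [D D0 hD] := rels_bound (@slam_adj R n) (@slam_mul R n) (@snrm0 R n)
  (@snrm1 R n) (@snrmN R n) (@snrmD R n) (@snrmM R n) (@slam_bound R n) certificate_valid.
exists D => // N.
pose W w := wsum lam w N.
have coefD (f g : {poly %/ ('X^(n.+1) : {poly R})}) : (f + g)`_n = f`_n + g`_n.
  exact: coefD.
have coef_lev p : (lev W p)`_n = lev (fun w => wcoef w n (fun s => zsum R s N)) p.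
  elim: p => [|[c w] p IHp]; first by rewrite !lev_nil coef0.
  rewrite !lev_cons coefD IHp -(@coef_wsum R n w N n (leqnn n)) -/lam; congr (_ + _).
  have natP m (f : {poly %/ ('X^(n.+1) : {poly R})}) : (m%:R * f)`_n = m%:R * f`_n.
    elim: m => [|m IHm]; first by rewrite !mul0r coef0.
    by rewrite !mulrSr !mulrDl !mul1r coefD IHm.
  case: c => m; first exact: natP.
  by rewrite NegzE !mulrNz !mulNr coefN natP.
set cert := flatten (map rel_lin certificate) in hD *.
set diff := lcollect (target_lin ++ lscale (-1) cert).
have diffE : lev W diff = lev W target_lin - lev W cert.
  by rewrite lev_lcollect [LHS]lev_cat lev_opp.
have tE : lev W target_lin = lev W cert + lev W diff by rewrite diffE addrCA subrr addr0.
have gapE : 2 * identity_gap n (fun s => zsum R s N) =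
    (lev W cert)`_n.
  rewrite -target_lin_gap // -coef_lev tE coefD [X in _ + X]coef_lev.
  rewrite [X in _ + X]big1_seq ?addr0 // => x /andP[_ xin].
  (* A leftover word has coefficient 0 or is a monomial of degree less than $5\le n$. *)
  case/orP: (allP certificateP x xin) => [/eqP-> |/andP[x0 x5]]; first by rewrite mul0r.
  by rewrite wcoef_shift0 ?mulr0 // (leq_trans x5).
have : `|2 * identity_gap n (fun s => zsum R s N)| <= D * (gauge R N ^+ 4 / N.+1%:R).
  rewrite gapE; apply: le_trans (hD N); rewrite /snrm big_ord_recr /= lerDr.
  by apply: sumr_ge0 => i _.
rewrite normrM ger0_norm // => h; apply: le_trans h.
by rewrite ler_peMl // ler1n.
Qed.

(** * Passage to the limit *)

Section Limit.

Variable R : realType.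

Lemma cvg_sum_cond (I : Type) (r : seq I) (P : pred I) (u : I -> nat -> R) (lim : I -> R) :
  (forall i, P i -> u i @ \oo --> lim i) ->
  (fun N => \sum_(i <- r | P i) u i N) @ \oo --> \sum_(i <- r | P i) lim i.
Proof.
move=> hu; elim: r => [|i r IHr].
  rewrite big_nil; under eq_fun do rewrite big_nil.
  exact: cvg_cst.
rewrite big_cons; under eq_fun do rewrite big_cons.
by case: ifP => // Pi; apply: cvgD => //; exact: hu.
Qed.

Lemma cvg_sum_nat (a b : nat) (P : pred nat) (u : nat -> nat -> R) (lim : nat -> R) :
  (forall i, (a <= i < b)%N -> P i -> u i @ \oo --> lim i) ->
  (fun N => \sum_(a <= i < b | P i) u i N) @ \oo --> \sum_(a <= i < b | P i) lim i.
Proof.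
move=> hu; rewrite big_nat_cond; under eq_fun do rewrite big_nat_cond.
by apply: cvg_sum_cond => i /andP[]; exact: hu.
Qed.

Lemma zsum_cvg_mzv i s : (1 < i)%N -> all (fun x => 0 < x)%N s ->
  (fun N => zsum R (i :: s) N) @ \oo --> mzv R (i :: s).
Proof. by move=> i1 ps; have [B hB] := zsum_bound R i1 ps; exact: zsum_cvg hB. Qed.

Lemma gauge_ratio_cvg0 : (fun N => gauge R N ^+ 4 / N.+1%:R) @ \oo --> (0 : R).
Proof.
apply/cvgrPdist_le => e e0.
have e20 : 0 < e ^+ 2 by rewrite exprn_gt0.
(* The harmonic sequence bounds the square of the ratio, hence the tolerance $e^2$. *)
have /cvgrPdist_le /(_ _ e20) := @cvg_harmonic R.
apply: filterS => N; rewrite !sub0r !normrN /= => hN.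
have g0 : 0 <= gauge R N ^+ 4 / N.+1%:R by rewrite mulr_ge0 ?exprn_ge0 ?gauge_ge0 ?invr_ge0.
rewrite ger0_norm // -(ler_pXn2r (n := 2)) ?nnegrE ?(ltW e0) //.
apply: le_trans hN; rewrite ger0_norm ?invr_ge0 //.
rewrite exprMn -exprM exprVn expr2 invfM mulrA ler_piMl ?invr_ge0 //.
by rewrite ler_pdivrMr // mul1r; exact: gauge_pow8.
Qed.

(** The gap is a finite linear combination of values with leading exponent at least 2, so
    convergence is termwise. *)
Lemma identity_gap_cvg n : (5 <= n)%N ->
  (fun N => identity_gap n (fun s => zsum R s N)) @ \oo --> identity_gap n (mzv R).
Proof.
move=> n5; have adm2 : (1 < n - 2)%N by lia.
have cvgMl (c : R) (u : nat -> R) (a : R) : u @ \oo --> a -> (fun N => c * u N) @ \oo --> c * a.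
  by move=> ua; apply: cvgM => //; exact: cvg_cst.
apply: cvgB; first apply: cvgB; first apply: cvgB.
- apply: cvgMl; apply: cvg_sum_nat => i /andP[i2 _] _; apply: cvg_sum_nat => j /andP[j1 _] _.
  apply: cvg_sum_nat => k /andP[k1 _] _; apply: zsum_cvg_mzv => //=.
  by rewrite j1 k1.
- apply: cvg_sum_nat => i /andP[i2 _] _; apply: cvg_sum_nat => j /andP[j1 _] _.
  apply: cvg_sum_nat => k /andP[k1 _] _; apply: cvg_sum_nat => m /andP[m1 _] _.
  by apply: cvgMl; apply: zsum_cvg_mzv => //=; rewrite j1 k1 m1.
- apply: cvg_sum_nat => i /andP[i2 _] _; apply: cvg_sum_nat => j /andP[j1 _] _.
  by apply: cvgMl; apply: zsum_cvg_mzv => //=; rewrite j1.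
- apply: cvgB; first apply: cvgB; first apply: cvgD.
  + by apply: cvgMl; apply: zsum_cvg_mzv => //=; lia.
  + by apply: cvgMl; apply: zsum_cvg_mzv.
  + by apply: cvgMl; apply: zsum_cvg_mzv => //=; lia.
  + by apply: cvgMl; apply: zsum_cvg_mzv => //=; lia.
Qed.

(** The truncated gaps tend both to the gap of the zeta values and, by [certificate_bound], to 0. *)
Lemma identity_gap_mzv n : (5 <= n)%N -> identity_gap n (mzv R) = 0.
Proof.
move=> n5; have [D D0 hD] := certificate_bound R n5.
rewrite -(cvg_lim (@Rhausdorff R) (identity_gap_cvg n5)).
apply: (cvg_lim (@Rhausdorff R)).
have D_cvg0 : (fun N => D * (gauge R N ^+ 4 / N.+1%:R)) @ \oo --> (0 : R).
  rewrite -[X in _ --> X](mulr0 D); apply: cvgM; first exact: cvg_cst.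
  exact: gauge_ratio_cvg0.
apply: (@squeeze_cvgr _ _ _ _ (fun N => - (D * (gauge R N ^+ 4 / N.+1%:R)))
  (fun N => D * (gauge R N ^+ 4 / N.+1%:R))) => //.
  by apply: nearW => N; rewrite -ler_norml.
by rewrite -[X in _ --> X]oppr0; apply: cvgN.
Qed.

End Limit.

Theorem corollary5p2 (R : realType) (n : nat) (hn : (5 <= n)%N) :
  2 * (\sum_(2 <= i < n) \sum_(1 <= j < n)
         \sum_(1 <= l < n | (i + j + l == n - 1)%N)
           mzv R [:: i; 1; j; l]%N)
  - (\sum_(2 <= i < n) \sum_(1 <= j < n) \sum_(1 <= k < n)
       \sum_(1 <= l < n | (i + j + k + l == n)%N)
         (2 ^+ (i - 1) + 2 ^+ k) * mzv R [:: i; j; k; l])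
  - (\sum_(2 <= k < n) \sum_(1 <= j < n | (k + j == n - 1)%N)
       k%:R * mzv R [:: k; 1; j]%N)
  = 2 * mzv R [:: 2; n - 2]%N
    + (n%:R - 3) * mzv R [:: n - 2; 2]%N
    - (2 * n%:R - 5) * mzv R [:: n - 1; 1]%N
    - (n%:R + 5) / 2 * mzv R [:: n].
Proof. by apply/eqP; rewrite -subr_eq0; apply/eqP; exact: identity_gap_mzv. Qed.
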